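(* (Complementary-dual principle) Let $(\bar{\mathbf x},\bar\lambda,\bar\mu,\bar\varsigma)\in(\mathbb R^n\times\mathbb R^n)\times\mathbb R\times\mathbb R\times\mathbb R$ be a stationary point of $\Xi$ (with respect to all of its variables) such that $(\bar\lambda,\bar\mu,\bar\varsigma)\in\mathcal S_a$. Then $\bar{\mathbf x}$ is a critical point of $(\mathcal P)$ with $\bar\lambda$ and $\bar\mu$ its Lagrange multipliers, $(\bar\lambda,\bar\mu,\bar\varsigma)$ is a stationary point of $\Pi^d$, and $$\Pi(\bar{\mathbf x})=L(\bar{\mathbf x},\bar\lambda,\bar\mu)=\Xi(\bar{\mathbf x},\bar\lambda,\bar\mu,\bar\varsigma)=\Pi^d(\bar\lambda,\bar\mu,\bar\varsigma).$$
   Context: Let $\mathbf A\in\mathbb R^{n\times n}$ be a (symmetric) positive definite matrix, let $\alpha,r,\eta>0$, and let $\mathbf f,\mathbf c\in\mathbb R^n$. Define $h,g:\mathbb R^n\to\mathbb R$ by $$h(\mathbf y)=\tfrac12\left(\mathbf y^t\mathbf A\mathbf y-r^2\right),\qquad g(\mathbf z)=\tfrac12\alpha\left(\tfrac12\|\mathbf z-\mathbf c\|^2-\eta\right)^2-\mathbf f^t(\mathbf z-\mathbf c),$$ and $\mathcal Y_c=\{\mathbf y\in\mathbb R^n:h(\mathbf y)=0\}$, $\mathcal Z_c=\{\mathbf z\in\mathbb R^n:g(\mathbf z)=0\}$, $\mathcal X_c=\mathcal Y_c\times\mathcal Z_c$. Standing assumption: $\mathbf f,\mathbf c$ are such that $\mathcal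 Y_c\cap\mathcal Z_c=\emptyset$ and $h(\mathbf z)>0$ for every $\mathbf z\in\mathcal Z_c$. Write $\mathbf x=(\mathbf y,\mathbf z)\in\mathbb R^n\times\mathbb R^n$. The primal problem is $$(\mathcal P):\ \min\left\{\Pi(\mathbf x)=\tfrac12\|\mathbf y-\mathbf z\|^2:\ h(\mathbf y)=0,\ g(\mathbf z)=0\right\},$$ with Lagrangian $L(\mathbf x,\lambda,\mu)=\tfrac12\|\mathbf y-\mathbf z\|^2+\lambda h(\mathbf y)+\mu g(\mathbf z)$, $\lambda,\mu\in\mathbb R$. A point $\mathbf x$ is a critical point of $(\mathcal P)$ with Lagrange multipliers $\lambda,\mu$ if $\mathbf x\in\mathcal X_c$ and $\nabla_{\mathbf x}L(\mathbf x,\lambda,\mu)=0$. Let $\Lambda(\mathbf z)=\tfrac12\|\mathbf z-\mathbf c\|^2$ and $V^*(\varsigma)=\tfrac1{2\alpha}\varsigma^2+\eta\varsigma$. The total complementary function is $$\Xi(\mathbf x,\lambda,\mu,\varsigma)=\tfrac12\|\mathbf y-\mathbf z\|^2+\lambda h(\mathbf y)+\mu\left(\Lambda(\mathbf z)\varsigma-V^*(\varsigma)-\mathbf f^t(\mathbf z-\mathbf c)\right).$$ With $\mathbf I$ the $n\times n$ identity matrix, the dual feasible space is $$\mathcal S_a=\{(\lambda,\mu,\varsigma)\in\mathbb R^3:\ (1+\mu\varsigma)(\mathbf I+\lambda\mathbf A)-\mathbf I\ \text{is invertible}\}.$$ For $(\lambda,\mu,\varsigma)\in\mathcal S_a$,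 the equation $\nabla_{\mathbf x}\Xi(\mathbf x,\lambda,\mu,\varsigma)=0$ has the unique solution $$\mathbf x(\lambda,\mu,\varsigma)=\begin{bmatrix}\mu\left((1+\mu\varsigma)(\mathbf I+\lambda\mathbf A)-\mathbf I\right)^{-1}(\mathbf f+\varsigma\mathbf c)\\ \mu(\mathbf I+\lambda\mathbf A)\left((1+\mu\varsigma)(\mathbf I+\lambda\mathbf A)-\mathbf I\right)^{-1}(\mathbf f+\varsigma\mathbf c)\end{bmatrix}$$ (first block $\mathbf y$, second block $\mathbf z$), and the canonical dual function $\Pi^d:\mathcal S_a\to\mathbb R$ is $\Pi^d(\lambda,\mu,\varsigma)=\Xi(\mathbf x(\lambda,\mu,\varsigma),\lambda,\mu,\varsigma)$. *)

(* Defs.v *)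
From HB Require Import structures.
From mathcomp Require Import all_boot all_order all_algebra.
From mathcomp Require Import all_classical all_reals all_analysis.

Set Implicit Arguments.
Unset Strict Implicit.
Unset Printing Implicit Defensive.

Import Order.TTheory GRing.Theory Num.Theory.
Import numFieldNormedType.Exports.

Local Open Scope classical_set_scope.
Local Open Scope ring_scope.

Section StationaryPoints.
Context {R : realType} {V : normedModType R}.

(* The gradient of f exists at p (in the Frechet sense) and vanishes there. *)
Definition stationary (f : V -> R) (p : V) : Prop :=
  differentiable f p /\ 'd f p = 0 :> (V -> R).

End StationaryPoints.

Section CanonicalDuality.
Context {R : realType} {n : nat}.
Implicit Types (A : 'M[R]_n) (f c u v y z : 'cV[R]_n).
Implicit Types (alpha r eta lambda mu sigma : R).
Implicit Types x : 'cV[R]_n * 'cV[R]_n.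

Definition posdefmx A : Prop :=
  A^T = A /\ forall v, v != 0 -> 0 < (v^T *m A *m v) 0 0.

Definition dotv u v : R := (u^T *m v) 0 0.

(* Square of the Euclidean norm; the library's `|v| on matrices is the max
   norm. *)
Definition sqnorm v : R := dotv v v.

Definition hfun A r y : R := ((y^T *m A *m y) 0 0 - r ^+ 2) / 2.

Definition gfun alpha eta f c z : R :=
  alpha / 2 * (sqnorm (z - c) / 2 - eta) ^+ 2 - dotv f (z - c).

Definition Yc A r : set 'cV[R]_n := [set y | hfun A r y = 0].

Definition Zc alpha eta f c : set 'cV[R]_n :=
  [set z | gfun alpha eta f c z = 0].

Definition Xc A alpha r eta f c : set ('cV[R]_n * 'cV[R]_n) :=
  Yc A r `*` Zc alpha eta f c.

Definition Pi x : R := sqnorm (x.1 - x.2) / 2.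

Definition Lagrangian A alpha r eta f c x lambda mu : R :=
  Pi x + lambda * hfun A r x.1 + mu * gfun alpha eta f c x.2.

Definition critical_point A alpha r eta f c x lambda mu : Prop :=
  Xc A alpha r eta f c x /\
  stationary (fun x' => Lagrangian A alpha r eta f c x' lambda mu) x.

Definition Lam c z : R := sqnorm (z - c) / 2.

Definition Vstar alpha eta sigma : R :=
  sigma ^+ 2 / (2 * alpha) + eta * sigma.

Definition Xi A alpha r eta f c x lambda mu sigma : R :=
  sqnorm (x.1 - x.2) / 2 + lambda * hfun A r x.1
  + mu * (Lam c x.2 * sigma - Vstar alpha eta sigma - dotv f (x.2 - c)).

Definition dual_mx A lambda mu sigma : 'M[R]_n :=
  (1 + mu * sigma) *: (1%:M + lambda *: A) - 1%:M.

Definition Sa A : set (R * R * R) :=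
  [set s | dual_mx A s.1.1 s.1.2 s.2 \in unitmx].

Definition xdual A f c lambda mu sigma : 'cV[R]_n * 'cV[R]_n :=
  let w := invmx (dual_mx A lambda mu sigma) *m (f + sigma *: c) in
  (mu *: w, mu *: ((1%:M + lambda *: A) *m w)).

(* Meaningful on Sa only: elsewhere invmx is the identity function.  As Sa is
   open, the junk values do not affect differentials at points of Sa. *)
Definition Pid A alpha r eta f c lambda mu sigma : R :=
  Xi A alpha r eta f c (xdual A f c lambda mu sigma) lambda mu sigma.

End CanonicalDuality.

(* Main.v *)
Require Import Defs.
From HB Require Import structures.
From mathcomp Require Import all_boot all_order all_algebra.
From mathcomp Require Import all_classical all_reals all_analysis.
From mathcomp Require Import ring.
Set Implicit Arguments.
Unset Strict Implicit.
Unset Printing Implicit Defensive.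
Import Order.TTheory GRing.Theory Num.Theory.
Import numFieldNormedType.Exports.
Local Open Scope classical_set_scope.
Local Open Scope ring_scope.

(** Stationarity of Xi in lambda, mu and sigma gives h(y) = 0, the vanishing of
   the bracket multiplied by mu, and mu (Lam(z) - sigma/alpha - eta) = 0; in x it
   is a linear system whose unique solution on S_a is x(lambda, mu, sigma).  If mu
   were 0 this solution would be y = 0, against h(0) = -r^2/2 < 0; hence
   sigma = alpha (Lam(z) - eta), and g(z) = 0 by Legendre duality.  Both L and Pi^d
   are Xi composed with a differentiable map through the stationary point,
   x |-> (x, lambda, mu, alpha (Lam(z) - eta)) for L and s |-> (x(s), s) for Pi^d,
   so the chain rule makes them stationary. *)

(** * Stationary points of real functions on a normed space *)

Section Stationary.
Context {R : realType}.
Implicit Types V W : normedModType R.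

(** This little-o form mentions only values of [F], so it can be transferred between functions that
    agree near [p]. *)
Lemma stationaryP V (F : V -> R) (p : V) :
  stationary F p <->
  forall e : R, 0 < e -> \forall h \near (0 : V), `|F (h + p) - F p| <= e * `|h|.
Proof.
split=> [[/diff_locally dF F0]|dF].
  by move: dF; rewrite F0 addr0 => /eqaddoP.
(* The zero map satisfies the first-order expansion of [F] at [p], so it is the differential by
   uniqueness. *)
pose z : {linear V -> R} := \0.
have Fo : F \o shift p = cst (F p) + z +o_ (0 : V) id.
  by apply/eqaddoP => e e0; rewrite [cst _ + _]addr0; exact: dF.
have zc : continuous z by move=> ?; exact: cvg_cst.
have F0 : 'd F p = 0 :> (V -> R) by rewrite (diff_unique zc Fo).
split=> //; apply/diff_locallyP; rewrite F0; split; first by move=> ?; exact: cvg_cst.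
exact: Fo.
Qed.

Lemma stationary_comp V W (F : W -> R) (G : V -> W) (p : V) :
  differentiable G p -> stationary F (G p) -> stationary (F \o G) p.
Proof.
move=> dG [dF F0]; split; first exact: differentiable_comp.
by rewrite diff_comp// F0.
Qed.

Lemma stationary_near_eq V (F G : V -> R) (p : V) :
  (\forall q \near p, F q = G q) -> stationary F p -> stationary G p.
Proof.
move=> FG /stationaryP sF; apply/stationaryP => e e0.
have FGp : F p = G p := nbhs_singleton FG.
move: FG; rewrite (near_shift 0 p) subr0 /= => FG.
near=> h.
have <- : F (h + p) = G (h + p) by near: h; exact: FG.
by rewrite -FGp; near: h; exact: sF.
Unshelve. all: by end_near. Qed.

(** The number [b] is the derivative of [F] at [p] along [v]: for nonzero [t] the difference
    quotient is [b + t * c]. Partial derivatives can thus be read off from polynomial identities. *)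
Lemma stationary_line V (F : V -> R) (p v : V) (b c : R) :
  stationary F p ->
  (forall t : R, F (p + t *: v) = F p + t * b + t ^+ 2 * c) -> b = 0.
Proof.
move=> [dF F0] Fline.
suff <- : 'D_v F p = b by rewrite deriveE// F0.
have cvb : (fun t : R => b + t * c) @ 0^' --> b.
  have : (fun t : R => b + t * c) @ (0 : R) --> b + 0 * c.
    by apply: cvgD; [exact: cvg_cst|apply: cvgMr_tmp; exact: cvg_id].
  by rewrite mul0r addr0; apply: cvg_trans; apply: cvg_app; exact: nbhs_dnbhs.
apply: cvg_lim => //; apply: cvg_trans cvb; apply: near_eq_cvg.
near=> t.
have t0 : t != 0 by near: t; exact: nbhs_dnbhs_neq.
rewrite /= [_ + p]addrC Fline /GRing.scale /=.
by field.
Unshelve. all: by end_near. Qed.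

End Stationary.

(** * Differentiability of determinants, adjugates and products, entry by entry *)

Section EntrywiseDifferentiability.
Context {R : realType} {V : normedModType R}.

Lemma differentiable_bigsum (I : Type) (s : seq I) (P : pred I)
    (F : I -> V -> R) (p : V) :
  (forall i, differentiable (F i) p) ->
  differentiable (fun q => \sum_(i <- s | P i) F i q) p.
Proof.
move=> dF; elim: s => [|i s IH].
  by rewrite (_ : (fun _ => _) = cst 0)//; apply/funext => q; rewrite big_nil.
case: (boolP (P i)) => Pi.
  rewrite (_ : (fun _ => _) = F i + (fun q => \sum_(j <- s | P j) F j q)).
    exact: differentiableD.
  by apply/funext => q; rewrite big_cons Pi.
by rewrite (_ : (fun _ => _) = (fun q => \sum_(j <- s | P j) F j q))//;
  apply/funext => q; rewrite big_cons (negbTE Pi).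
Qed.

Lemma differentiable_bigprod (I : Type) (s : seq I) (P : pred I)
    (F : I -> V -> R) (p : V) :
  (forall i, differentiable (F i) p) ->
  differentiable (fun q => \prod_(i <- s | P i) F i q) p.
Proof.
move=> dF; elim: s => [|i s IH].
  by rewrite (_ : (fun _ => _) = cst 1)//; apply/funext => q; rewrite big_nil.
case: (boolP (P i)) => Pi.
  rewrite (_ : (fun _ => _) = F i * (fun q => \prod_(j <- s | P j) F j q)).
    exact: differentiableM.
  by apply/funext => q; rewrite big_cons Pi.
by rewrite (_ : (fun _ => _) = (fun q => \prod_(j <- s | P j) F j q))//;
  apply/funext => q; rewrite big_cons (negbTE Pi).
Qed.

Lemma differentiableMl (a : R) (F : V -> R) (p : V) :
  differentiable F p -> differentiable (fun q => a * F q) p.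
Proof. exact: (@differentiableZ _ _ _ _ a). Qed.

Lemma differentiable_det n (M : V -> 'M[R]_n) (p : V) :
  (forall i j, differentiable (fun q => M q i j) p) ->
  differentiable (fun q => \det (M q)) p.
Proof.
move=> dM; apply: differentiable_bigsum => s.
apply: differentiableMl; exact: differentiable_bigprod.
Qed.

Lemma differentiable_adj n (M : V -> 'M[R]_n) (p : V) :
  (forall i j, differentiable (fun q => M q i j) p) ->
  forall i j, differentiable (fun q => (\adj (M q)) i j) p.
Proof.
move=> dM i j.
under eq_fun do rewrite mxE /cofactor.
apply: differentiableMl; apply: differentiable_det => k l.
by under eq_fun do rewrite !mxE.
Qed.

Lemma differentiable_mulmx_entry m n k (M : V -> 'M[R]_(m, n))
    (N : V -> 'M[R]_(n, k)) (p : V) :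
  (forall i j, differentiable (fun q => M q i j) p) ->
  (forall i j, differentiable (fun q => N q i j) p) ->
  forall i j, differentiable (fun q => (M q *m N q) i j) p.
Proof.
move=> dM dN i j; under eq_fun do rewrite mxE.
by apply: differentiable_bigsum => l; exact: differentiableM.
Qed.

Lemma differentiable_mx m n (M : V -> 'M[R]_(m, n)) (p : V) :
  (forall i j, differentiable (fun q => M q i j) p) -> differentiable M p.
Proof.
move=> dM.
have -> : M = \sum_(i < m) \sum_(j < n) (fun q => M q i j *: delta_mx i j).
  apply/funext => q; rewrite [LHS]matrix_sum_delta fct_sumE.
  by apply: eq_bigr => i _; rewrite fct_sumE.
apply: differentiable_sum => i; apply: differentiable_sum => j.
exact: differentiableZl.
Qed.

End EntrywiseDifferentiability.

(** * Bilinearity and definiteness of the dot product *)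

Section DotProduct.
Context {R : realType} {n : nat}.
Implicit Types (u v w : 'cV[R]_n) (A : 'M[R]_n) (t r : R).

Lemma dotvE u v : dotv u v = \sum_i u i 0 * v i 0.
Proof. by rewrite /dotv mxE; apply: eq_bigr => i _; rewrite mxE. Qed.

Lemma dotvC u v : dotv u v = dotv v u.
Proof. by rewrite !dotvE; apply: eq_bigr => i _; rewrite mulrC. Qed.

Lemma dotvDr u v w : dotv u (v + w) = dotv u v + dotv u w.
Proof. by rewrite /dotv mulmxDr mxE. Qed.

Lemma dotvNr u v : dotv u (- v) = - dotv u v.
Proof. by rewrite /dotv mulmxN mxE. Qed.

Lemma dotvZr t u v : dotv u (t *: v) = t * dotv u v.
Proof. by rewrite /dotv -scalemxAr mxE. Qed.

Lemma dotvDl u v w : dotv (v + w) u = dotv v u + dotv w u.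
Proof. by rewrite dotvC dotvDr !(dotvC u). Qed.

Lemma dotvNl u v : dotv (- v) u = - dotv v u.
Proof. by rewrite dotvC dotvNr dotvC. Qed.

Lemma dotvZl t u v : dotv (t *: v) u = t * dotv v u.
Proof. by rewrite dotvC dotvZr dotvC. Qed.

Lemma dotv_mulmxC A u v : A^T = A -> dotv u (A *m v) = dotv v (A *m u).
Proof. by move=> AT; rewrite dotvC /dotv trmx_mul AT mulmxA. Qed.

Lemma sqnorm_eq0 v : sqnorm v = 0 -> v = 0.
Proof.
rewrite /sqnorm dotvE => /eqP.
rewrite psumr_eq0 => [/allP v0|i _]; last by rewrite -expr2 sqr_ge0.
apply/matrixP => i j; rewrite ord1 mxE.
by have := v0 i (mem_index_enum i); rewrite /= mulf_eq0 orbb => /eqP.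
Qed.

Lemma hfunE A r v : hfun A r v = (dotv v (A *m v) - r ^+ 2) / 2.
Proof. by rewrite /hfun /dotv mulmxA. Qed.

End DotProduct.

(** * First-order conditions at a stationary point of [Xi] *)

Section StationaryXi.
Context {R : realType} {n : nat}.
Context (A : 'M[R]_n) (alpha r eta : R) (f c y z : 'cV[R]_n).
Context (lambda mu sigma : R).
Hypothesis A_sym : A^T = A.
Hypothesis Xi_stationary :
  stationary
    (fun p : ('cV[R]_n * 'cV[R]_n) * (R * R * R) =>
       Xi A alpha r eta f c p.1 p.2.1.1 p.2.1.2 p.2.2)
    ((y, z), (lambda, mu, sigma)).

(** Along a line that moves only one of the five variables, [Xi] is a polynomial of degree at most
    two in [t]; its linear coefficient [e] is the partial derivative. *)
Lemma Xi_stationary_line (u w : 'cV[R]_n) (a b d e k : R) :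
  (forall t, Xi A alpha r eta f c (y + t *: u, z + t *: w)
                 (lambda + t * a) (mu + t * b) (sigma + t * d)
             = Xi A alpha r eta f c (y, z) lambda mu sigma + t * e + t ^+ 2 * k) ->
  e = 0.
Proof.
exact: (stationary_line (v := ((u, w), (a, b, d)) : _ * _ * (R * R * R)) Xi_stationary).
Qed.

Lemma Xi_stationary_lambda : hfun A r y = 0.
Proof.
apply: (@Xi_stationary_line 0 0 1 0 0 _ 0) => t.
by rewrite !scaler0 !mulr0 !addr0 /Xi /=; ring.
Qed.

Lemma Xi_stationary_mu :
  Lam c z * sigma - Vstar alpha eta sigma - dotv f (z - c) = 0.
Proof.
apply: (@Xi_stationary_line 0 0 0 1 0 _ 0) => t.
by rewrite !scaler0 !mulr0 !addr0 /Xi /=; ring.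
Qed.

Lemma Xi_stationary_sigma (alpha_neq0 : alpha != 0) :
  mu * (Lam c z - sigma / alpha - eta) = 0.
Proof.
(* The quadratic coefficient comes from the term [- mu * Vstar]. *)
apply: (@Xi_stationary_line 0 0 0 0 1 _ (- mu / (2 * alpha))) => t.
rewrite !scaler0 !mulr0 !addr0 /Xi /Vstar /=.
by field; rewrite alpha_neq0.
Qed.

Lemma Xi_stationary_y : y - z + lambda *: (A *m y) = 0.
Proof.
(* A vector orthogonal to every [u] is orthogonal to itself, hence zero. *)
suff uH u : dotv u (y - z + lambda *: (A *m y)) = 0 by apply: sqnorm_eq0; exact: uH.
(* The coefficient of [t ^+ 2] is half the Hessian form in [y] at [u]; symmetry of [A] merges the
   two cross terms of [hfun]. *)
apply: (@Xi_stationary_line u 0 0 0 0 _ ((sqnorm u + lambda * dotv u (A *m u)) / 2)) => t.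
rewrite !scaler0 !mulr0 !addr0 /Xi /= !hfunE /sqnorm.
rewrite !(mulmxDr, dotvDl, dotvDr, dotvNl, dotvNr, dotvZl, dotvZr, =^~scalemxAr).
rewrite (dotv_mulmxC y u A_sym) (dotvC y u) (dotvC z u).
by field.
Qed.

Lemma Xi_stationary_z : z - y + mu *: (sigma *: (z - c) - f) = 0.
Proof.
suff uH u : dotv u (z - y + mu *: (sigma *: (z - c) - f)) = 0.
  by apply: sqnorm_eq0; exact: uH.
apply: (@Xi_stationary_line 0 u 0 0 0 _ ((1 + mu * sigma) * sqnorm u / 2)) => t.
rewrite !scaler0 !mulr0 !addr0 /Xi /= /Lam /sqnorm.
rewrite !(mulmxDr, dotvDl, dotvDr, dotvNl, dotvNr, dotvZl, dotvZr).
rewrite (dotvC y u) (dotvC z u) (dotvC c u) (dotvC f u) (dotvC z y) (dotvC z c).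
by field.
Qed.

(** The [y]-equation says [(I + lambda A) y = z], so the left side is [(1 + mu sigma) z - y], which
    the [z]-equation evaluates. *)
Lemma Xi_stationary_dual_mx :
  dual_mx A lambda mu sigma *m y = mu *: (f + sigma *: c).
Proof.
have zE : z = y + lambda *: (A *m y).
  by apply/eqP; rewrite eq_sym -subr_eq0 addrAC Xi_stationary_y.
have yE : y = z + mu *: (sigma *: (z - c) - f).
  by apply/eqP; rewrite eq_sym -subr_eq0 addrAC Xi_stationary_z.
rewrite /dual_mx mulmxBl mul1mx -scalemxAl mulmxDl mul1mx -scalemxAl -zE.
rewrite {1}yE.
rewrite scalerDl scale1r !scalerDr !scalerN !scalerA.
by apply/matrixP => i j; rewrite !mxE; ring.
Qed.

Hypothesis in_Sa : Sa A (lambda, mu, sigma).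

(** Inverting the dual matrix gives the first block; applying [I + lambda A] to it gives the second,
    by the [y]-equation. *)
Lemma Xi_stationary_xdual : (y, z) = xdual A f c lambda mu sigma.
Proof.
have yE : y = mu *: (invmx (dual_mx A lambda mu sigma) *m (f + sigma *: c)).
  by rewrite scalemxAr -Xi_stationary_dual_mx mulKmx.
rewrite /xdual -yE scalemxAr -yE mulmxDl mul1mx -scalemxAl; congr (_, _).
by apply/eqP; rewrite eq_sym -subr_eq0 addrAC Xi_stationary_y.
Qed.

Lemma Xi_stationary_mu_neq0 : r != 0 -> mu != 0.
Proof.
move=> r0; apply/eqP => mu0; have := Xi_stationary_lambda.
have [-> _] := Xi_stationary_xdual; rewrite mu0 scale0r hfunE mulmx0.
(* Writing the zero vector as [0 *: 0] lets homogeneity cancel the quadratic form, leaving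
   [- r ^+ 2 / 2 = 0]. *)
rewrite -(scale0r (0 : 'cV_n)) dotvZl mul0r sub0r => /eqP.
by rewrite mulf_eq0 oppr_eq0 expf_eq0 /= (negbTE r0) invr_eq0 pnatr_eq0.
Qed.

End StationaryXi.

(** * Differentiability of [Lam] and of the dual solution map *)

Section Differentiability.
Context {R : realType} {n : nat}.
Context (A : 'M[R]_n) (f c : 'cV[R]_n).

Lemma differentiable_Lam (z : 'cV[R]_n) : differentiable (Lam c) z.
Proof.
have dc i j : differentiable (fun z : 'cV[R]_n => (z - c) i j) z.
  under eq_fun do rewrite !mxE.
  apply: (@differentiableD _ _ _ (fun z : 'cV[R]_n => z i j) (cst (- c i j))) => //.
  exact: differentiable_coord.
rewrite /Lam; under eq_fun do rewrite mulrC /sqnorm.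
apply: differentiableMl; apply: differentiable_mulmx_entry => // i j.
by under eq_fun do rewrite mxE.
Qed.

Lemma differentiable_fst (U W : normedModType R) (p : U * W) :
  differentiable fst p.
Proof. by apply: (@linear_differentiable _ _ _ fst) => q; exact: cvg_fst. Qed.

Lemma differentiable_snd (U W : normedModType R) (p : U * W) :
  differentiable snd p.
Proof. by apply: (@linear_differentiable _ _ _ snd) => q; exact: cvg_snd. Qed.

Variable s : (R * R * R)%type.

Let dlambda : differentiable (fun s : R * R * R => s.1.1) s.
Proof. apply: (differentiable_comp (f := fst)); exact: differentiable_fst. Qed.

Let dmu : differentiable (fun s : R * R * R => s.1.2) s.
Proof.
apply: (differentiable_comp (f := fst)); first exact: differentiable_fst.
exact: differentiable_snd.
Qed.

Let dsigma : differentiable (fun s : R * R * R => s.2) s.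
Proof. exact: differentiable_snd. Qed.

Lemma differentiable_dual_mx i j :
  differentiable (fun s : R * R * R => dual_mx A s.1.1 s.1.2 s.2 i j) s.
Proof.
under eq_fun do rewrite !mxE.
apply: (differentiableB (g := cst _)) => //.
apply: (differentiableM (f := fun s : R * R * R => 1 + s.1.2 * s.2)).
  apply: (differentiableD (f := cst (1 : R))
    (g := fun s : R * R * R => s.1.2 * s.2)) => //.
  exact: differentiableM.
apply: (differentiableD (f := cst _)) => //.
exact: (differentiableM (g := cst _)).
Qed.

(** Openness of [Sa], by continuity of the determinant; near [s] the map [xdual] can therefore be
    replaced by [xdual_adj]. *)
Lemma det_dual_mx_neq0_near :
  Sa A s -> \forall q \near s, \det (dual_mx A q.1.1 q.1.2 q.2) != 0.
Proof.
move=> sSa; have d0 : \det (dual_mx A s.1.1 s.1.2 s.2) != 0.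
  by rewrite -unitfE -unitmxE.
have /differentiable_continuous := differentiable_det differentiable_dual_mx.
by move/cvgr_neq0; apply.
Qed.

(* Agrees with xdual on Sa and avoids the case distinction inside invmx. *)
Definition xdual_adj (q : R * R * R) : 'cV[R]_n * 'cV[R]_n :=
  let B := dual_mx A q.1.1 q.1.2 q.2 in
  let w := ((\det B)^-1 *: \adj B) *m (f + q.2 *: c) in
  (q.1.2 *: w, q.1.2 *: ((1%:M + q.1.1 *: A) *m w)).

Lemma xdual_adjE (q : R * R * R) : \det (dual_mx A q.1.1 q.1.2 q.2) != 0 ->
  xdual A f c q.1.1 q.1.2 q.2 = xdual_adj q.
Proof. by move=> d0; rewrite /xdual /invmx unitmxE unitfE d0. Qed.

(** By Cramer's formula the entries are rational in the three parameters, and the only denominator,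
    the determinant, is nonzero at [s]. *)
Lemma differentiable_xdual_adj : Sa A s -> differentiable xdual_adj s.
Proof.
move=> /det_dual_mx_neq0_near/nbhs_singleton d0.
have dB := differentiable_dual_mx.
have dw i j : differentiable (fun q : R * R * R =>
    (((\det (dual_mx A q.1.1 q.1.2 q.2))^-1 *: \adj (dual_mx A q.1.1 q.1.2 q.2))
      *m (f + q.2 *: c)) i j) s.
  apply: differentiable_mulmx_entry => {i j} i j.
    under eq_fun do rewrite mxE.
    apply: differentiableM; last exact: differentiable_adj.
    by apply: differentiableV => //; exact: differentiable_det.
  under eq_fun do rewrite !mxE.
  apply: (differentiableD (f := cst _) (g := fun q : R * R * R => q.2 * c i j)) => //.
  exact: (differentiableM (g := cst _)).
apply: differentiable_pair; apply: differentiable_mx => i j.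
  under eq_fun do rewrite mxE.
  exact: differentiableM.
under eq_fun do rewrite mxE.
apply: differentiableM => //.
apply: differentiable_mulmx_entry => // {i j} i j.
under eq_fun do rewrite !mxE.
apply: (differentiableD (f := cst _) (g := fun q : R * R * R => q.1.1 * A i j)) => //.
exact: (differentiableM (g := cst _)).
Qed.

End Differentiability.

Theorem theorem2p2 (R : realType) (n : nat) (A : 'M[R]_n)
    (alpha r eta : R) (f c : 'cV[R]_n)
    (A_posdef : posdefmx A)
    (alpha_gt0 : 0 < alpha) (r_gt0 : 0 < r) (eta_gt0 : 0 < eta)
    (YZ_disjoint : Yc A r `&` Zc alpha eta f c = set0)
    (h_gt0_on_Z : forall z, Zc alpha eta f c z -> 0 < hfun A r z)
    (x : 'cV[R]_n * 'cV[R]_n) (lambda mu sigma : R)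
    (Xi_stationary :
      stationary
        (fun p : ('cV[R]_n * 'cV[R]_n) * (R * R * R) =>
           Xi A alpha r eta f c p.1 p.2.1.1 p.2.1.2 p.2.2)
        (x, (lambda, mu, sigma)))
    (in_Sa : Sa A (lambda, mu, sigma)) :
  [/\ critical_point A alpha r eta f c x lambda mu,
      stationary
        (fun s : R * R * R => Pid A alpha r eta f c s.1.1 s.1.2 s.2)
        (lambda, mu, sigma),
      Pi x = Lagrangian A alpha r eta f c x lambda mu,
      Lagrangian A alpha r eta f c x lambda mu
        = Xi A alpha r eta f c x lambda mu sigma
    & Xi A alpha r eta f c x lambda mu sigma
        = Pid A alpha r eta f c lambda mu sigma].
Proof.
case: x Xi_stationary => y z sXi; have A_sym := A_posdef.1.
have alpha0 := lt0r_neq0 alpha_gt0.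
have hy := Xi_stationary_lambda sXi.
have gz0 := Xi_stationary_mu sXi.
have mu0 := Xi_stationary_mu_neq0 A_sym sXi in_Sa (lt0r_neq0 r_gt0).
have xE := Xi_stationary_xdual A_sym sXi in_Sa.
have sigmaE : sigma = alpha * (Lam c z - eta).
  have /eqP := Xi_stationary_sigma sXi alpha0.
  rewrite mulf_eq0 (negbTE mu0) /= => /eqP E.
  (* Adding [- alpha] times the vanishing factor [E] to the right side turns it into [sigma]. *)
  by rewrite -[RHS]addr0 -[in RHS](mulr0 (- alpha)) -E; field.
(* V* is the Legendre conjugate of V(t) = alpha (t - eta)^2 / 2. *)
have LXi x' : Lagrangian A alpha r eta f c x' lambda mu =
    Xi A alpha r eta f c x' lambda mu (alpha * (Lam c x'.2 - eta)).
  by rewrite /Lagrangian /Xi /gfun /Vstar /Pi /Lam; field.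
have gz : gfun alpha eta f c z = 0.
  by rewrite -gz0 sigmaE /gfun /Vstar /Lam; field.
split.
- split; first by split.
  rewrite (_ : (fun _ => _) =
    (fun p : ('cV[R]_n * 'cV[R]_n) * (R * R * R) =>
       Xi A alpha r eta f c p.1 p.2.1.1 p.2.1.2 p.2.2) \o
    (fun x' => (x', (lambda, mu, alpha * (Lam c x'.2 - eta))))); last first.
    by apply/funext => x'; rewrite LXi.
  (* By [sigmaE] the inner map sends [(y, z)] to the given stationary point of [Xi]. *)
  apply: stationary_comp; last by rewrite /= -sigmaE.
  apply: (differentiable_pair (f := id)) => //.
  apply: (differentiable_pair (f := cst _)) => //.
  apply: differentiableMl.
  apply: (differentiableB (g := cst _)) => //.
  apply: (differentiable_comp (f := snd)); first exact: differentiable_snd.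
  exact: differentiable_Lam.
- have near0 := det_dual_mx_neq0_near in_Sa.
  have xE' : xdual_adj A f c (lambda, mu, sigma) = (y, z).
    by rewrite xE -xdual_adjE//; exact: (nbhs_singleton near0).
  (* [Pid] is exchanged for its adjugate version, equal to it wherever the determinant is nonzero,
     hence near the point. *)
  apply: (@stationary_near_eq _ _
    ((fun p : ('cV[R]_n * 'cV[R]_n) * (R * R * R) =>
       Xi A alpha r eta f c p.1 p.2.1.1 p.2.1.2 p.2.2) \o
     (fun s => (xdual_adj A f c s, s)))).
    by near=> s; rewrite /= /Pid xdual_adjE//; near: s.
  apply: stationary_comp; last by rewrite xE'.
  by apply: differentiable_pair => //; exact: differentiable_xdual_adj.
- by rewrite /Lagrangian hy gz !mulr0 !addr0.
- by rewrite LXi -sigmaE.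
- by rewrite /Pid -xE.
Unshelve. all: by end_near. Qed.
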